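(* Let $G$ be a finite group and let $\mathbb{F}_qG$ be a finite semisimple group algebra. Let $K$ be a normal subgroup of $G$ such that $G/K=\langle gK\rangle$ for some $g\in G$. Let $C\in\mathcal{R}(G/K)$ and let $e:=e_C(G,G,K)$ be the corresponding primitive central idempotent. Then the code $\mathbb{F}_qGe$ satisfies the following: (i) $\dim_{\mathbb{F}_q}(\mathbb{F}_qGe)=o_{|G/K|}(q)$; (ii) the set $\mathcal{B}:=\{e,eg,\ldots,eg^{\,o_{|G/K|}(q)-1}\}$ is an $\mathbb{F}_q$-basis of $\mathbb{F}_qGe$; (iii) $2|K|\leq d\leq \operatorname{wt}(e)$, where $d$ is the minimum distance of the code $\mathbb{F}_qGe$ and $\operatorname{wt}(e)$ is the weight of the idempotent $e$. In particular, if $|G/K|=p^j$, where $j\in\mathbb{N}$ and $p$ is an odd prime such that $o_{p^j}(q)=\phi(p^j)$, then the minimum distance of the code generated by $e$ is $2|K|$.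
   Context: $\mathbb{F}_q$ is the field with $q$ elements; semisimplicity of $\mathbb{F}_qG$ means $\gcd(q,|G|)=1$. $o_n(q)$ is the multiplicative order of $q$ modulo $n$, and $\phi$ is Euler's totient function. For $\alpha=\sum_{g\in G}\alpha_g g\in\mathbb{F}_qG$ the weight is $\operatorname{wt}(\alpha)=|\{g\in G:\alpha_g\neq0\}|$; the minimum distance of a nonzero ideal is the minimum weight of its nonzero elements. For $K\trianglelefteq G$ with $G/K$ cyclic, $\operatorname{Irr}(G/K)$ is the group of homomorphisms from $G/K$ to $\overline{\mathbb{F}}_q^{\,*}$ (a cyclic group of order $|G/K|$). For a generator $\gamma$ of $\operatorname{Irr}(G/K)$, its $q$-cyclotomic coset is $C_q(\gamma)=\{\gamma,\gamma^q,\ldots,\gamma^{q^{o-1}}\}$ with $o=o_{|G/K|}(q)$. $\mathcal{C}(G/K)$ is the set of $q$-cyclotomic cosets containing generators of $\operatorname{Irr}(G/K)$. $\mathcal{R}(G/K)$ is the set of orbits of $\mathcal{C}(G/K)$ under the conjugation action of $G$; here this action is trivial, so $\mathcal{R}(G/K)=\mathcal{C}(G/K)$. For $C=C_q(\chi)$, $$e_C(G,G,K)=\frac{1}{[G:K]}\,\widehat{K}\sum_{\overline{h}\in G/K}\operatorname{tr}(\chi(\overline h))\,h^{-1},$$ where $\widehat K=\frac1{|K|}\sum_{x\in K}x$, $h$ is any representative of $\overline h$, and $\operatorname{tr}$ is the trace from $\mathbb{F}_q(\xi_{[G:K]})$ to $\mathbb{F}_q$, with $\xi_{[G:K]}$ a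 primitive $[G:K]$-th root of unity in $\overline{\mathbb{F}}_q$. This is a primitive central idempotent of $\mathbb{F}_qG$.
   Formalization: The lower bound 2|K| ≤ d is stated only for K ≠ G, and the last claim only for j ≥ 1: when K = G the code is spanned by the average of G and d = |G| = |K|, so both claims fail there. *)

(* Defs.v *)
From mathcomp Require Import all_boot all_order all_algebra all_fingroup.
From mathcomp Require Import all_solvable all_field mxrepresentation.

Set Implicit Arguments.
Unset Strict Implicit.
Unset Printing Implicit Defensive.

Import GroupScope GRing.Theory.
Local Open Scope ring_scope.

(* The least k > 0 with q ^ k = 1 modulo n.  When q and n are coprime and      *)
(* n > 0 such a k is at most n, so the bounded search succeeds.               *)
Definition mulorder (n q : nat) : nat :=
  find (fun k => (0 < k)%N && (q ^ k == 1 %[mod n])) (iota 0 n.+1).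

Lemma mulorderP n q : (0 < n)%N -> coprime q n ->
  [/\ (0 < mulorder n q)%N, q ^ mulorder n q == 1 %[mod n]
    & forall k, (0 < k)%N -> q ^ k == 1 %[mod n] -> (mulorder n q <= k)%N].
Proof.
move=> n0 cop; rewrite /mulorder; set P := fun k => _.
have H : has P (iota 0 n.+1).
  apply/hasP; exists (totient n); last first.
    by rewrite /P totient_gt0 n0 /= Euler_exp_totient.
  rewrite mem_iota /= add0n ltnS totient_count_coprime.
  apply: leq_trans (_ : (\sum_(0 <= d < n) 1 <= _)%N).
    by apply: leq_sum => d _; case: coprime.
  by rewrite sum_nat_const_nat muln1 subn0.
have lo : (find P (iota 0 n.+1) < n.+1)%N.
  by rewrite -[X in (_ < X)%N](size_iota 0 n.+1) -has_find.
have := nth_find 0%N H; rewrite nth_iota // add0n => /andP[a b].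
split=> // k k0 Hk; rewrite leqNgt; apply/negP => lk.
have := before_find 0%N lk; rewrite nth_iota ?add0n /P ?k0 ?Hk //.
exact: ltn_trans lo.
Qed.

Section Characters.

Variables (hT : finGroupType) (L : fieldType).
Implicit Types (A : {group hT}) (chi psi : {ffun hT -> L}).

(* Irr(A), the homomorphisms from A to L^*.  As for class functions in the    *)
(* library, they are extended by 0 outside A, so that equality of such        *)
(* functions is equality of homomorphisms on A.                               *)
Definition lin_chars A : {pred {ffun hT -> L}} :=
  [pred chi : {ffun hT -> L} | [forall x, (chi x != 0) == (x \in A)]
            && [forall x in A, forall y in A, chi (x * y)%g == chi x * chi y]].

Definition char_exp A chi (k : nat) : {ffun hT -> L} :=
  [ffun x => if x \in A then chi x ^+ k else 0].

Definition generates_chars A chi : Prop :=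
  chi \in lin_chars A /\
  forall psi, psi \in lin_chars A -> exists k, psi = char_exp A chi k.

Definition cyclotomic_coset (q : nat) A chi : seq {ffun hT -> L} :=
  [seq char_exp A chi (q ^ i) | i <- iota 0 (mulorder #|A| q)].

(* Membership of C in the set of the q-cyclotomic cosets of generators.       *)
Definition is_cyclotomic_class (q : nat) A (C : {pred {ffun hT -> L}}) : Prop :=
  exists2 gamma, generates_chars A gamma & C =i cyclotomic_coset q A gamma.

End Characters.

(* For an extension E of F embedded in L by j, the trace from j(E) to F.      *)
(* galTrace has values in E; they are pulled back to F along c |-> c%:A.      *)
Definition subfield_trace (F : finFieldType) (E : splittingFieldType F)
    (L : fieldType) (j : E -> L) (y : L) : F :=
  odflt 0 [pick c : F |
    [exists x : finvect_type E,
      (j x == y) && (galTrace 1%AS {:E} x == c%:A :> E)]].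

Lemma subfield_traceE (F : finFieldType) (E : splittingFieldType F)
    (L : fieldType) (j : {rmorphism E -> L}) (x : E) :
  (subfield_trace j (j x))%:A = galTrace 1%AS {:E} x.
Proof.
rewrite /subfield_trace; case: pickP => [c | ] /=.
  by case/existsP=> y /andP[/eqP/fmorph_inj-> /eqP->].
have gal : galois 1%AS {:E} by exact: finField_galois (sub1v _).
have := galTrace_fixedField 1%AS (memvf x).
rewrite (galois_fixedField gal) => /vlineP[c Hc] /(_ c)/negbT/existsP[].
by exists (x : finvect_type E); rewrite eqxx Hc eqxx.
Qed.

(* The group algebra of G over F is modelled by the regular representation:  *)
(* sum_x a_x x is the matrix sum_x a_x *: regular_repr F G x.                 *)
Section GroupAlgebra.

Variables (F : finFieldType) (gT : finGroupType) (G : {group gT}).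
Implicit Types (A e : 'M[F]_#|G|) (C : {vspace 'M[F]_#|G|}).

Local Notation aG := (regular_repr F G).

Definition group_algebra : {vspace 'M[F]_#|G|} := <<[seq aG x | x in G]>>%VS.

Lemma mem_group_algebra A :
  (A \in group_algebra) = (A \in group_ring F G)%MS.
Proof.
apply/idP/idP => [/coord_span-> | /envelop_mxP[a ->]].
  rewrite linear_sum summx_sub // => i _; rewrite linearZ scalemx_sub //=.
  have lt_i : (i < size [seq aG x | x in G])%N by rewrite size_image.
  by have /imageP[x Gx ->] := mem_nth 0 lt_i; apply: envelop_mx_id.
by apply: rpred_sum => x Gx; rewrite rpredZ // memv_span // image_f.
Qed.

Definition coef A (x : gT) : F := gring_row A 0 (gring_index G x).

Lemma coef_sum (a : gT -> F) x : x \in G ->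
  coef (\sum_(y in G) a y *: aG y) x = a x.
Proof.
move=> Gx; rewrite /coef linear_sum summxE (bigD1 x) //=.
rewrite big1 => [|y /andP[Gy yx]].
  rewrite linearZ addr0 /= /gring_row rowK gring_indexK // mul1g.
  by rewrite !mxE !eqxx mulr1.
rewrite linearZ /= /gring_row rowK gring_indexK // mul1g !mxE eqxx /=.
rewrite (inj_in_eq (can_in_inj (@gring_indexK _ G))) //.
by rewrite eq_sym (negPf yx) mulr0.
Qed.

Definition wt A : nat := #|[set x in G | coef A x != 0]|.

Definition left_ideal e : {vspace 'M[F]_#|G|} :=
  (linfun (mulmxr e) @: group_algebra)%VS.

(* Weights are at most #|G|, so the default #|G| is never smaller than the    *)
(* minimum when C is nonzero.                                                 *)
Definition min_distance C : nat :=
  \big[minn/#|G|]_(A : 'M[F]_#|G| | (A \in C) && (A != 0)) wt A.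

Definition avg_idem (K : {group gT}) : 'M[F]_#|G| :=
  #|K|%:R^-1 *: \sum_(x in K) aG x.

Definition central_idem (L : fieldType) (tr : L -> F) (K : {group gT})
    (chi : {ffun coset_of K -> L}) : 'M[F]_#|G| :=
  #|G : K|%:R^-1 *:
    (avg_idem K *m
     \sum_(hb in (G / K)%g) tr (chi hb) *: aG (repr hb)^-1%g).

End GroupAlgebra.

(* Main.v *)
(* Let theta = chi(gK), a primitive n-th root of unity with n = |G/K|, let E  *)
(* = F(theta) and T the trace of E / F.  The map                              *)
(*   Phi(y) = |G|^-1 sum_x T(y chi(x^-1)) x                                   *)
(* from E to FG satisfies Phi(1) = e and Phi(y) x = x Phi(y) = Phi(y chi(x)), *)
(* and it is injective because the trace form is nondegenerate.  Hence FGe =  *)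
(* Phi(E), the e g^i are the images of the power basis of E, and the weight   *)
(* of Phi(y) is |K| times the number of i modulo n with T(y theta^i) <> 0.    *)
(* As the powers of theta sum to 0 this number is never 1, and when n = p^k   *)
(* and [E : F] = phi(n), choosing T(y theta^i) freely for i < phi(n) makes it *)
(* equal to 2.                                                                *)

Require Import Defs.
From HB Require Import structures.
From mathcomp Require Import all_boot all_order all_algebra all_fingroup.
From mathcomp Require Import all_solvable all_field mxrepresentation.

Set Implicit Arguments.
Unset Strict Implicit.
Unset Printing Implicit Defensive.

Import GroupScope Order.TTheory GRing.Theory.
Local Open Scope ring_scope.

(** The code is a copy of the field [E]. Multiplying [trace_word y] (the map Phi) by [x] on either
    side multiplies [y] by [lam x], so the ideal of [e = trace_word 1] ([central_idemE]) is the
    image of [E] ([left_ideal_trace_word]), and nondegeneracy of the trace form makes the map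
    injective ([trace_word_eq0]). The dimension is thus [[E : F]], which is the order of q modulo n
    because Frobenius generates the Galois group ([dim_Fadjoin_root_unity]); the basis is the image
    of the powers of [lam g]. The coefficients of a codeword are constant on the cosets of [K] and,
    for [K] proper in [G], sum to 0, so a nonzero codeword meets at least two cosets
    ([leq_wt_trace_word]). In the prime power case [trace_form_dual_basis] yields a codeword
    supported on only two. *)

(** * Extensions generated by a root of unity *)

Lemma dim_Fadjoin_root_unity (F : finFieldType) (E : splittingFieldType F)
    (n : nat) (theta : E) :
  coprime #|F| n -> n.-primitive_root theta -> <<1; theta>>%VS = fullv ->
  \dim {:E} = mulorder n #|F|.
Proof.
move=> cop prim_theta Etheta; have n_gt0 := prim_order_gt0 prim_theta.
have [o_gt0 oP o_min] := mulorderP n_gt0 cop.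
have [alpha /eqP genE frobE] := finField_galois_generator (sub1v {:E}).
(* Frobenius generates the Galois group of E / F, so its order is \dim E; *)
(* its k-th power is trivial iff it fixes theta.                          *)
have alphaX k x : (alpha ^+ k)%g x = x ^+ (#|F| ^ k).
  elim: k x => [|k IHk] x; first by rewrite expg0 gal_id expr1.
  by rewrite expgS galM ?memvf // IHk frobE ?memvf // dimv1 expn1 -exprM expnS.
have alpha1 k : (alpha ^+ k == 1)%g = (#|F| ^ k == 1 %[mod n]).
  rewrite -(eq_prim_root_expr prim_theta) expr1 -alphaX.
  apply/idP/eqP => [/eqP->|fix_theta]; first by rewrite gal_id.
  apply/gal_eqP => x _; rewrite gal_id alphaX.
  have /Fadjoin1_polyP[p ->] : x \in <<1; theta>>%VS by rewrite Etheta memvf.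
  rewrite -alphaX -horner_map /= fix_theta -map_poly_comp.
  by congr _.[_]; apply: eq_map_poly => a /=; rewrite linearZ /= rmorph1.
have -> : \dim {:E} = #[alpha]%g.
  rewrite orderE -genE -galois_dim ?finField_galois ?sub1v //.
  by rewrite dimv1 divn1.
apply/eqP; rewrite eqn_leq o_min ?order_gt0 -?alpha1 ?expg_order // andbT.
by rewrite dvdn_leq // order_dvdn alpha1.
Qed.

Lemma power_basis (F : fieldType) (E : fieldExtType F) (theta : E) :
  <<1; theta>>%VS = fullv ->
  basis_of {:E} [seq theta ^+ i | i <- iota 0 (\dim {:E})].
Proof.
move=> Etheta; rewrite basisEdim size_map size_iota leqnn andbT.
apply/subvP=> v _.
have Ev : v \in <<1; theta>>%VS by rewrite Etheta memvf.
rewrite -(Fadjoin_poly_eq Ev).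
have degE : adjoin_degree 1 theta = \dim {:E}.
  by rewrite adjoin_degreeE dimv1 divn1 Etheta.
rewrite (horner_coef_wide _ (size_Fadjoin_poly _ _ _)) degE.
apply: rpred_sum => i _.
have /polyOverP/(_ i)/vlineP[c ->] := Fadjoin_polyOver 1 theta v.
by rewrite mulr_algl rpredZ // memv_span // map_f // mem_iota /=.
Qed.

(** * Bounds on the minimum distance *)

Section MinDistance.

Variables (F : finFieldType) (gT : finGroupType) (G : {group gT}).
Implicit Types (A : 'M[F]_#|G|) (C : {vspace 'M[F]_#|G|}).

Lemma min_distance_le C A :
  A \in C -> A != 0 -> (min_distance C <= wt A)%N.
Proof.
move=> CA nzA; rewrite /min_distance -leEnat -minEnat.
by apply: bigmin_le_cond; rewrite CA.
Qed.

(** The condition [m <= #|G|] accounts for the default value of the minimum. *)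
Lemma min_distance_ge C m : (m <= #|G|)%N ->
  (forall A, A \in C -> A != 0 -> (m <= wt A)%N) -> (m <= min_distance C)%N.
Proof.
move=> leqmG lemwt; rewrite /min_distance -leEnat -minEnat.
by apply: le_bigmin => // A /andP[]; apply: lemwt.
Qed.

End MinDistance.

(** * Nondegeneracy of the form T(yw) *)

Section TraceForm.

Variables (F : fieldType) (E : fieldExtType F) (T : {linear E -> F^o}).
Hypothesis nzT : exists z, T z != 0.

(** Multiplication by a nonzero [y] is onto [E], so [T] would vanish everywhere. *)
Lemma trace_form_nondegenerate (X : seq E) y : <<X>>%VS = fullv ->
  {in X, forall w, T (y * w) = 0} -> y = 0.
Proof.
move=> spanX TyX; have Ty w : T (y * w) = 0.
  have := memvf w; rewrite -spanX => /(@coord_span _ _ _ (in_tuple X))->.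
  rewrite mulr_sumr linear_sum big1 // => i _.
  by rewrite -scalerAr linearZ /= TyX ?mem_nth // scaler0.
case: nzT => z nzTz; apply/eqP; apply: contraNT nzTz => nzy.
by rewrite -[z](mulVKf nzy) Ty.
Qed.

Lemma trace_form_dual_basis n (X : n.-tuple E) (f : 'I_n -> F) :
  basis_of fullv X -> exists y, forall i : 'I_n, T (y * X`_i) = f i.
Proof.
case/andP=> /eqP spanX freeX.
(* An injective endomorphism of E, hence onto. *)
pose h y := \sum_(i < n) (T (y * X`_i) : F) *: X`_i.
have h_linear : linear h.
  move=> a u v; rewrite /h scaler_sumr -big_split; apply: eq_bigr => i _ /=.
  by rewrite mulrDl -scalerAl linearP /= scalerDl scalerA.
pose hL := GRing.isLinear.Build F E E *:%R h h_linear.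
pose hl : {linear E -> E} := HB.pack h hL.
have hE y : linfun hl y = h y by rewrite lfunE.
have ker0 : lker (linfun hl) == 0%VS.
  rewrite -subv0; apply/subvP=> y; rewrite memv_ker hE => /eqP hy0.
  rewrite memv0; apply/eqP/(trace_form_nondegenerate spanX) => w.
  case/(nthP 0) => i; rewrite size_tuple => lt_i <-.
  by have /freeP/(_ (fun l : 'I_n => T (y * X`_l)) hy0 (Ordinal lt_i)) := freeX.
have /memv_imgP[y _ hy] : \sum_i f i *: X`_i \in limg (linfun hl).
  by rewrite lker0_limgf ?memvf.
exists y => i; move: hy; rewrite hE => /(congr1 (coord X i)).
by rewrite !coord_sum_free.
Qed.

End TraceForm.

(** * The code of trace words, for an abstract multiplicative [lam] with kernel [K] *)

Section TraceCode.

Variables (F : finFieldType) (gT : finGroupType) (G K : {group gT}).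
Variables (E : fieldExtType F) (T : {linear E -> F^o}) (lam : gT -> E).
Hypothesis lamM : {in G &, {morph lam : x y / (x * y)%g >-> x * y}}.
Hypothesis lamK : {in G, forall x, (lam x == 1) = (x \in K)}.
Hypothesis span_lam : <<[seq lam x | x in G]>>%VS = fullv.
Hypotheses (sKG : K \subset G) (F'G : #|G|%:R != 0 :> F).
Hypothesis nzT : exists z, T z != 0.

Local Notation aG := (regular_repr F G).

(** This is Phi; [lam] stands for [chi] composed with the quotient map, its values pulled back to
    [E]. *)
Definition trace_word (y : E) : 'M[F]_#|G| :=
  #|G|%:R^-1 *: \sum_(x in G) (T (y * lam x^-1%g) : F) *: aG x.

Fact trace_word_is_linear : linear trace_word.
Proof.
move=> a u v; rewrite /trace_word !scaler_sumr -big_split /=.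
apply: eq_bigr => x _; rewrite mulrDl -scalerAl linearP /= scalerDl scalerDr.
by congr (_ + _); rewrite !scalerA mulrCA mulrA.
Qed.
HB.instance Definition _ :=
  GRing.isLinear.Build F E 'M[F]_#|G| *:%R trace_word trace_word_is_linear.

Lemma coef_trace_word y x : x \in G ->
  coef (trace_word y) x = #|G|%:R^-1 * T (y * lam x^-1%g).
Proof.
move=> Gx; rewrite /trace_word scaler_sumr.
by under eq_bigr do rewrite scalerA; rewrite Defs.coef_sum.
Qed.

Let lam1 : lam 1%g = 1.
Proof. by apply/eqP; rewrite lamK. Qed.

Lemma trace_word_mulr y x : x \in G ->
  trace_word y *m aG x = trace_word (y * lam x).
Proof.
move=> Gx; rewrite /trace_word -scalemxAl mulmx_suml; congr (_ *: _).
rewrite [RHS](reindex_acts 'R _ Gx) ?astabsR //=.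
apply: eq_bigr => u Gu; rewrite -scalemxAl -repr_mxM //; congr (T _ *: _).
by rewrite invMg -mulrA -lamM ?groupM ?groupV // mulKVg.
Qed.

Lemma trace_word_mull y x : x \in G ->
  aG x *m trace_word y = trace_word (y * lam x).
Proof.
move=> Gx; rewrite /trace_word -scalemxAr mulmx_sumr; congr (_ *: _).
rewrite [RHS](reindex_inj (mulgI x)) /=.
under [RHS]eq_bigl do rewrite groupMl //.
apply: eq_bigr => u Gu; rewrite -scalemxAr -repr_mxM //; congr (T _ *: _).
by rewrite invMg -mulrA [lam x * _]mulrC -lamM ?groupM ?groupV // mulgKV.
Qed.

(** The coefficient at the inverse of [x] is T(y [lam x]) up to an invertible factor, and the
    [lam x] span [E]. *)
Lemma trace_word_eq0 y : trace_word y = 0 -> y = 0.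
Proof.
move=> y0; have Tlam x : x \in G -> T (y * lam x) = 0.
  move=> Gx; have Gx' := groupVr Gx.
  have := coef_trace_word y Gx'; rewrite y0 invgK /coef linear0 mxE.
  by move/esym/eqP; rewrite mulf_eq0 invr_eq0 (negPf F'G) => /eqP.
apply: (trace_form_nondegenerate nzT span_lam) => _ /imageP[x Gx ->].
exact: Tlam.
Qed.

Lemma lker_trace_word : lker (linfun trace_word) == 0%VS.
Proof.
rewrite -subv0; apply/subvP=> y; rewrite memv_ker lfunE /=.
move/eqP/trace_word_eq0->.
exact: mem0v.
Qed.

Lemma left_ideal_trace_word :
  left_ideal (trace_word 1) = (linfun trace_word @: fullv)%VS.
Proof.
rewrite /left_ideal /group_algebra -span_lam !limg_span -!map_comp.
congr <<_>>%VS; apply/eq_in_map => x; rewrite mem_enum => Gx /=.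
by rewrite !lfunE /= trace_word_mull // mul1r.
Qed.

Lemma wt_trace_word y :
  wt (trace_word y) = #|[set x in G | T (y * lam x^-1%g) != 0]|.
Proof.
apply: eq_card => x; rewrite !inE; have [Gx|//] := boolP (x \in G).
by rewrite coef_trace_word // mulf_eq0 invr_eq0 (negPf F'G).
Qed.

Lemma trace_word_rcoset y x u : u \in G -> x \in K :* u ->
  T (y * lam x^-1%g) = T (y * lam u^-1%g).
Proof.
move=> Gu /rcosetP[k Kk ->]; have Gk := subsetP sKG k Kk.
rewrite invMg lamM ?groupV // (eqP (_ : lam k^-1 == 1)) ?mulr1 //.
by rewrite lamK groupV.
Qed.

(** Multiplication by [lam u], which is not 1 for [u] outside [K], only permutes the terms. *)
Lemma sum_lam : K \proper G -> \sum_(x in G) lam x = 0.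
Proof.
case/properP=> _ [u Gu notKu]; set s := \sum_(x in G) _.
have us : lam u * s = s.
  rewrite mulr_sumr [RHS](reindex_inj (mulgI u)) /=.
  under [RHS]eq_bigl do rewrite groupMl //.
  by apply: eq_bigr => x Gx; rewrite lamM.
apply/eqP; apply: contraNT notKu => nzs; rewrite -lamK //.
by apply/eqP/(mulIf nzs); rewrite us mul1r.
Qed.

(** The support is a nonempty union of cosets of [K], so it remains to exclude a single coset. *)
Lemma leq_wt_trace_word y : K \proper G -> y != 0 ->
  (2 * #|K| <= wt (trace_word y))%N.
Proof.
move=> ltKG nzy; rewrite wt_trace_word; set S := [set x in G | _].
have F'K : #|K|%:R != 0 :> F.
  apply: contraNneq F'G => K0.
  by rewrite -(Lagrange sKG) natrM K0 mul0r.
have sKS x : x \in S -> K :* x \subset S.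
  rewrite inE => /andP[Gx nzx]; apply/subsetP=> z Kxz.
  rewrite inE (trace_word_rcoset _ Gx Kxz) nzx andbT.
  by case/rcosetP: Kxz => k Kk ->; rewrite groupM // (subsetP sKG).
(* A word supported on a single coset would have a nonzero coefficient sum. *)
have sumT0 : \sum_(x in G) T (y * lam x^-1%g) = 0.
  rewrite -raddf_sum -mulr_sumr (reindex_inj invg_inj) /=.
  under eq_bigl do rewrite groupV.
  by under eq_bigr do rewrite invgK; rewrite sum_lam // mulr0 raddf0.
have [S0|[x Sx]] := set_0Vmem S.
  case/eqP: nzy; apply: trace_word_eq0.
  rewrite /trace_word big1 ?scaler0 // => x Gx.
  have /negbT := in_set0 x; rewrite -S0 inE Gx negbK => /eqP->.
  by rewrite scale0r.
have [sSKx|/subsetPn[z Sz notKxz]] := boolP (S \subset K :* x).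
  have := Sx; rewrite inE => /andP[Gx /negP[]].
  have sKxG : K :* x \subset G.
    apply: subset_trans (sKS x Sx) _.
    by apply/subsetP=> z; rewrite inE => /andP[].
  move: sumT0.
  rewrite (big_setID (K :* x)) /= (setIidPr sKxG) addrC big1 ?add0r.
    rewrite (eq_bigr (fun=> T (y * lam x^-1%g))); last first.
      by move=> z Kxz; apply: trace_word_rcoset.
    rewrite sumr_const card_rcoset => /eqP.
    by rewrite -[_ *+ _]mulr_natl mulf_eq0 (negPf F'K).
  move=> z /setDP[Gz notKxz]; apply/eqP; apply: contraNT notKxz => nz.
  by apply: (subsetP sSKx); rewrite inE Gz.
have disj : [disjoint K :* x & K :* z].
  rewrite disjoint_subset; apply/subsetP=> w Kxw; rewrite inE.
  apply: contra notKxz => Kzw.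
  by rewrite -(rcoset_eqP Kxw) (rcoset_eqP Kzw) rcoset_refl.
rewrite mul2n -addnn -{1}(card_rcoset K x) -{1}(card_rcoset K z).
have := disj; rewrite -leq_card_setU => /eqP <-.
by rewrite subset_leq_card // subUset !sKS.
Qed.


Local Notation code := (left_ideal (trace_word 1)).

Lemma min_distance_trace_code_ge :
  K \proper G -> (2 * #|K| <= min_distance code)%N.
Proof.
move=> ltKG; have ge2 y := @leq_wt_trace_word y ltKG.
apply: min_distance_ge => [|A].
  (* The side condition [2 * #|K| <= #|G|] follows from the weight bound for the word of 1. *)
  apply: leq_trans (ge2 1 (oner_neq0 _)) _.
  by apply/subset_leq_card/subsetP=> x; rewrite inE => /andP[].
rewrite left_ideal_trace_word => /memv_imgP[y _ ->]; rewrite lfunE => nzy.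
by apply: ge2; apply: contraNneq nzy => ->; rewrite linear0.
Qed.

Lemma min_distance_trace_code_le y : y != 0 ->
  (min_distance code <= wt (trace_word y))%N.
Proof.
move=> nzy; apply: min_distance_le; last first.
  by apply: contraNneq nzy => /trace_word_eq0->.
by rewrite left_ideal_trace_word -[trace_word y]lfunE memv_img ?memvf.
Qed.

Lemma dim_trace_code : \dim code = \dim {:E}.
Proof.
by rewrite left_ideal_trace_word limg_dim_eq // (eqP lker_trace_word) capv0.
Qed.

Lemma lam_exp g i : g \in G -> lam (g ^+ i)%g = lam g ^+ i.
Proof.
move=> Gg; elim: i => [|i IHi]; first by rewrite expg0 lam1.
by rewrite expgS exprS lamM ?groupX // IHi.
Qed.

Lemma basis_trace_code g m : g \in G ->
  basis_of {:E} [seq lam g ^+ i | i <- iota 0 m] ->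
  basis_of code [seq trace_word 1 *m aG (g ^+ i)%g | i <- iota 0 m].
Proof.
move=> Gg basisE; rewrite left_ideal_trace_word.
have -> : [seq trace_word 1 *m aG (g ^+ i)%g | i <- iota 0 m]
    = map (linfun trace_word) [seq lam g ^+ i | i <- iota 0 m].
  rewrite -map_comp; apply: eq_map => i /=.
  by rewrite lfunE /= trace_word_mulr ?groupX // mul1r lam_exp.
by apply: limg_basis_of; rewrite // (eqP lker_trace_word) capv0.
Qed.

Lemma min_distance_trace_code_prime_power g p k : g \in G ->
  (forall x, x \in G -> exists2 i, (i < p ^ k.+1)%N & x \in K :* (g ^+ i)%g) ->
  prime p -> (p ^ k.+1).-primitive_root (lam g) ->
  basis_of {:E} [seq lam g ^+ i | i <- iota 0 (totient (p ^ k.+1))] ->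
  K \proper G -> min_distance code = (2 * #|K|)%N.
Proof.
move=> Gg genG p_pr prim_g; set theta := lam g in prim_g *.
have p_gt0 := prime_gt0 p_pr; have p_gt1 := prime_gt1 p_pr.
set o := totient _ => basisE ltKG.
have oE : o = (p.-1 * p ^ k)%N by rewrite /o totient_pfactor.
have o_gt0 : (0 < o)%N by rewrite /o totient_gt0 expn_gt0 p_gt0.
have sizeX : size [seq theta ^+ i | i <- iota 0 o] == o.
  by rewrite size_map size_iota.
(* T (y theta^i) = 0 for 0 < i < phi(n); the relation 1 + omega + ...        *)
(* + omega^(p-1) = 0 with omega = theta^(p^k) extends this to every i < n     *)
(* other than 0 and phi(n), so that Phi(y) is supported on two cosets.        *)
have [y Ty] := trace_form_dual_basis nzT (X := Tuple sizeX)
  (fun i => (i == 0 :> nat)%:R) basisE.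
have {}Ty i : (i < o)%N -> T (y * theta ^+ i) = (i == 0)%:R.
  move=> lt_io; rewrite -(Ty (Ordinal lt_io)) /= (nth_map 0) ?size_iota //.
  by rewrite nth_iota.
have nzy : y != 0.
  apply/eqP=> y0; have := Ty 0 o_gt0; rewrite y0 mul0r linear0 => /esym/eqP.
  by rewrite eqxx oner_eq0.
(* The form [p.-1.+1] lets [big_ord_recr] split off the last term below. *)
have sum_omega : \sum_(i < p.-1.+1) (theta ^+ (p ^ k)) ^+ i = 0.
  rewrite prednK //.
  have nz : theta ^+ (p ^ k) - 1 != 0.
    rewrite subr_eq0 -(prim_order_dvd prim_g) gtnNdvd ?expn_gt0 ?p_gt0 //.
    by rewrite ltn_exp2l.
  apply: (mulfI nz); rewrite -subrX1 -exprM -expnSr (prim_expr_order prim_g).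
  by rewrite subrr mulr0.
have Ty0 i : (i < p ^ k.+1)%N -> i != 0 -> i != o -> T (y * theta ^+ i) = 0.
  move=> lt_i i0 io; case: (ltnP i o) => [lt_io|le_oi].
    by rewrite Ty // (negPf i0).
  (* The relation times [theta ^+ r] has last term [theta ^+ i]; its other exponents s p^k + r lie
     strictly between 0 and phi(n), where T is already known to vanish. *)
  pose r := (i - o)%N.
  have iE : i = (p.-1 * p ^ k + r)%N by rewrite -oE subnKC.
  have r_gt0 : (0 < r)%N by rewrite subn_gt0 ltn_neqAle eq_sym io.
  have lt_r : (r < p ^ k)%N.
    by rewrite -(ltn_add2l (p.-1 * p ^ k)) -iE -mulSnr prednK // -expnS.
  have /(congr1 (fun s => T (y * (s * theta ^+ r)))) := sum_omega.
  rewrite mul0r mulr0 linear0 big_ord_recr /=.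
  rewrite mulrDl mulrDr linearD /= -exprM -exprD [(p ^ k * _)%N]mulnC -iE.
  rewrite mulr_suml mulr_sumr linear_sum /= big1 ?add0r // => s _.
  rewrite -exprM -exprD mulnC Ty; last first.
    apply: leq_trans (_ : s.+1 * p ^ k <= o)%N.
      by rewrite mulSnr ltn_add2l.
    by rewrite oE leq_mul2r ltn_ord orbT.
  by rewrite addn_eq0 eqn0Ngt [r == 0]eqn0Ngt r_gt0 andbF.
apply/eqP; rewrite eqn_leq min_distance_trace_code_ge // andbT.
apply: leq_trans (min_distance_trace_code_le nzy) _; rewrite wt_trace_word.
(* The coefficient at [x] involves the inverse of [x], so the exponents 0 and [o] correspond to [K]
   and [g ^- o *: K]. *)
apply: (@leq_trans #|(K :|: g ^- o *: K)%g|); last first.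
  by rewrite mul2n -addnn -{2}(card_lcoset K (g ^- o)%g) leq_card_setU.
apply/subset_leq_card/subsetP=> x; rewrite inE => /andP[Gx].
have [i lt_i Kxi] := genG x^-1%g (groupVr Gx).
have -> : lam x^-1%g = theta ^+ i.
  case/rcosetP: Kxi => c Kc ->; have Gc := subsetP sKG c Kc.
  by rewrite lamM ?groupX // (eqP (_ : lam c == 1)) ?lamK // mul1r lam_exp.
move=> nzT_i; rewrite inE; case: (eqVneq i 0) Kxi => [-> |i0].
  by rewrite expg0 rcoset1 groupV => ->.
case: (eqVneq i o) => [-> |io]; last by rewrite Ty0 ?eqxx in nzT_i.
rewrite mem_rcoset mem_lcoset invgK -[(_ * x)%g \in K]groupV invMg => ->.
by rewrite orbT.
Qed.

End TraceCode.

(** * Characters of a cyclic group *)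

Section LinearCharacters.

Variables (hT : finGroupType) (L : fieldType).
Implicit Types (A : {group hT}) (chi psi : {ffun hT -> L}).

Lemma lin_charM A chi : chi \in lin_chars A ->
  {in A &, {morph chi : x y / (x * y)%g >-> x * y}}.
Proof. by case/andP=> _ /forall_inP chiM x y /chiM/forall_inP/[apply]/eqP. Qed.

Lemma lin_char_eq0 A chi x : chi \in lin_chars A -> (chi x == 0) = (x \notin A).
Proof. by case/andP=> /forallP/(_ x)/eqP<- _; rewrite negbK. Qed.

Lemma lin_char1 A chi : chi \in lin_chars A -> chi 1%g = 1.
Proof.
move=> Achi; have nz1 : chi 1%g != 0 by rewrite (lin_char_eq0 _ Achi) negbK.
by apply: (mulfI nz1); rewrite -(lin_charM Achi) // mulg1 mulr1.
Qed.

Lemma lin_charX A chi x i : chi \in lin_chars A -> x \in A ->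
  chi (x ^+ i)%g = chi x ^+ i.
Proof.
move=> Achi Ax; elim: i => [|i IHi]; first by rewrite expg0 (lin_char1 Achi).
by rewrite expgS exprS (lin_charM Achi) ?groupX // IHi.
Qed.

Lemma lin_char_exp1 A chi : chi \in lin_chars A -> char_exp A chi 1 = chi.
Proof.
move=> Achi; apply/ffunP=> x; rewrite ffunE expr1; case: ifPn => // notAx.
by apply/esym/eqP; rewrite (lin_char_eq0 _ Achi).
Qed.

(** Sending [x ^+ i] to [z ^+ i] is well defined because [z] has order dividing [#|A|]; [log] is the
    discrete logarithm to base [x]. *)
Lemma lin_char_of_root A x z : A :=: <[x]>%g -> z ^+ #|A| = 1 :> L ->
  exists2 psi, psi \in lin_chars A & psi x = z.
Proof.
move=> defA zA; have ordx : #|A| = #[x]%g by rewrite defA.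
pose log y := odflt 0 (omap val [pick i : 'I_#[x] | x ^+ i == y]%g).
have logK y : y \in A -> (x ^+ log y)%g = y.
  rewrite defA => /cyclePmin[i lt_i ->]; rewrite /log.
  by case: pickP => [l /eqP//|/(_ (Ordinal lt_i))]; rewrite eqxx.
have zlog i l : (x ^+ i = x ^+ l)%g -> z ^+ i = z ^+ l.
  move=> /eqP; rewrite eq_expg_mod_order -ordx => /eqP eq_il.
  by rewrite -(expr_mod i zA) eq_il expr_mod.
pose psi := [ffun y => if y \in A then z ^+ log y else 0].
have nzz : z != 0.
  apply: contra_eq_neq zA => ->; rewrite expr0n eqn0Ngt cardG_gt0.
  by rewrite eq_sym oner_eq0.
have Ax : x \in A by rewrite defA cycle_id.
exists psi; last by rewrite ffunE Ax -[RHS]expr1; apply: zlog; rewrite logK.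
apply/andP; split.
  apply/forallP=> y; rewrite ffunE; case: ifP => _; last by rewrite eqxx.
  by rewrite expf_neq0.
apply/forall_inP=> y Ay; apply/forall_inP=> w Aw; apply/eqP.
rewrite !ffunE groupM // Ay Aw -exprD; apply: zlog.
by rewrite expgD !logK ?groupM.
Qed.

(** The character sending [x] to the primitive root [z] is a power of [chi], so [z] is a power of
    [chi x], whose order is then a multiple of [#|A|]. *)
Lemma generates_chars_prim A x (z : L) chi : A :=: <[x]>%g ->
  #|A|.-primitive_root z -> generates_chars A chi ->
  #|A|.-primitive_root (chi x).
Proof.
move=> defA prim_z [Achi gen_chi]; have Ax : x \in A by rewrite defA cycle_id.
have chiA : chi x ^+ #|A| = 1.
  by rewrite -(lin_charX _ Achi) // defA expg_order (lin_char1 Achi).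
have [m prim_m dvd_m] := prim_order_exists (cardG_gt0 A) chiA.
have [psi Apsi psix] := lin_char_of_root defA (prim_expr_order prim_z).
have [l defpsi] := gen_chi _ Apsi.
suff <- : m = #|A| by []; apply/eqP.
rewrite eqn_dvd dvd_m (prim_order_dvd prim_z) -psix defpsi ffunE Ax.
by rewrite exprAC (prim_expr_order prim_m) expr1n eqxx.
Qed.

(** As [chi] lies in its own coset (exponent 0), it is a power q^i of a generator, and q^i is
    coprime to [#|A|]. *)
Lemma cyclotomic_coset_prim (q : nat) A x (z : L) C chi : A :=: <[x]>%g ->
  coprime q #|A| -> #|A|.-primitive_root z ->
  is_cyclotomic_class q A C -> C =i cyclotomic_coset q A chi ->
  chi \in lin_chars A -> #|A|.-primitive_root (chi x).
Proof.
move=> defA cop prim_z [gamma gen_gamma Cgamma] Cchi Achi.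
have Ax : x \in A by rewrite defA cycle_id.
have prim_gamma := generates_chars_prim defA prim_z gen_gamma.
have [o_gt0 _ _] := mulorderP (cardG_gt0 A) cop.
have : chi \in C.
  rewrite Cchi; apply/mapP; exists 0; first by rewrite mem_iota.
  by rewrite expn0 lin_char_exp1.
rewrite Cgamma => /mapP[i _ ->]; rewrite ffunE Ax.
by rewrite prim_root_exp_coprime // coprimeXl.
Qed.

End LinearCharacters.

(** * The field trace as a nonzero linear form *)

Section FieldTrace.

Variables (F : finFieldType) (E : splittingFieldType F) (L : fieldType).
Variable j : {rmorphism E -> L}.

Definition field_trace (x : E) : F^o := subfield_trace j (j x).

Fact field_trace_is_linear : linear field_trace.
Proof.
move=> a x y; apply: (fmorph_inj (in_alg E)); rewrite rmorphD /=.
rewrite -scalerA /field_trace !subfield_traceE raddfD; congr (_ + _).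
by rewrite /galTrace scaler_sumr; apply: eq_bigr => s _; rewrite linearZ.
Qed.
HB.instance Definition _ :=
  GRing.isLinear.Build F E F^o *:%R field_trace field_trace_is_linear.

(** The trace is the sum of the Galois automorphisms, which are linearly independent. *)
Lemma field_trace_neq0 : exists z, field_trace z != 0.
Proof.
have [|z _ nz] := @gal_independent_contra _ _ _
  [in 'Gal({:E} / 1%VS)%g] (fun=> 1) 1%g (group1 _); first exact: oner_neq0.
exists z; apply: contraNneq nz => Tz0.
under eq_bigr do rewrite mul1r.
by rewrite -[X in X == 0](subfield_traceE j) -/(field_trace z) Tz0 scale0r.
Qed.

End FieldTrace.

(** * Expansion of the idempotent; invertibility of group orders in [F] *)

Lemma central_idemE (F : finFieldType) (gT : finGroupType) (G K : {group gT})
    (L : fieldType) (tr : L -> F) (chi : {ffun coset_of K -> L}) : K <| G ->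
  central_idem G tr chi = #|G|%:R^-1 *:
    \sum_(u in G) tr (chi (coset K u^-1)) *: regular_repr F G u.
Proof.
case/andP=> sKG nKG; have nKK := subset_trans sKG nKG.
rewrite /central_idem /avg_idem -scalemxAl scalerA -invfM -natrM mulnC.
rewrite Lagrange //; congr (_ *: _).
(* The [u] whose inverse lies in the coset [hb] are the x h^-1 with x in [K] and h = [repr hb]: the
   terms of the product indexed by [hb]. *)
rewrite [RHS](partition_big (fun u => coset K u^-1) [in (G / K)%g]) /=;
  last by move=> u Gu; rewrite mem_quotient ?groupV.
rewrite mulmx_sumr; apply: eq_bigr => hb GKhb.
have Gr : repr hb \in G.
  have /morphimP[x Nx Gx ->] := GKhb.
  have := mem_repr_coset (coset K x); rewrite val_coset // => /rcosetP[k Kk ->].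
  by rewrite groupM // (subsetP sKG).
have Nr : repr hb \in 'N(K) := subsetP nKG _ Gr.
rewrite mulmx_suml [RHS](reindex_inj (mulIg (repr hb)^-1%g)) /=.
apply: eq_big => [x | x Kx].
  rewrite groupMr ?groupV // invMg invgK.
  apply/idP/andP => [Kx|[Gx]].
    have Nx := subsetP nKK x Kx; rewrite (subsetP sKG) //.
    by rewrite morphM ?groupV //= coset_reprK coset_id ?groupV // mulg1 eqxx.
  have Nx := subsetP nKG x Gx; rewrite morphM ?groupV //= coset_reprK.
  by move/eqP; rewrite -[RHS]mulg1 => /mulgI/coset_idr; rewrite !groupV; apply.
have Gx := subsetP sKG x Kx; rewrite -scalemxAr repr_mxM ?groupV //.
congr (tr (chi _) *: _).
have Nx := subsetP nKK x Kx; rewrite invMg invgK morphM ?groupV //= coset_reprK.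
by rewrite coset_id ?groupV // mulg1.
Qed.

(** The characteristic divides [#|F|], so it cannot divide [n] as well. *)
Lemma natr_card_neq0 (F : finFieldType) n : coprime #|F| n -> n%:R != 0 :> F.
Proof.
have [p p_pr charFp] := finPcharP F.
have F0 : #|F|%:R = 0 :> F.
  by have := expg_cardG (in_setT (1 : F)); rewrite cardsT FinRing.zmodXgE.
have pF : (p %| #|F|)%N by rewrite (dvdn_pcharf charFp) F0.
move=> cop; apply: contraL p_pr; rewrite -(dvdn_pcharf charFp) => pn.
by have := dvdn_gcd p #|F| n; rewrite (eqP cop) pF pn dvdn1 => /eqP->.
Qed.

(** * The code of the idempotent *)

Theorem theorem2p1
  (q : nat) (F : finFieldType) (card_F : #|F| = q)
  (* an algebraic closure of F *)
  (Fbar : closedFieldType) (iota : {rmorphism F -> Fbar})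
  (alg_Fbar : integralRange iota)
  (gT : finGroupType) (G K : {group gT}) (g : gT)
  (semisimple : coprime q #|G|)
  (nKG : K <| G) (Gg : g \in G) (cycGK : (G / K)%g = <[coset K g]>%g)
  (* the field F(xi), xi a primitive [G:K]-th root of unity, inside Fbar *)
  (E : splittingFieldType F) (j : {rmorphism E -> Fbar})
  (j_iota : forall a : F, j a%:A = iota a)
  (xi : E) (prim_xi : #|G : K|.-primitive_root xi)
  (E_xi : <<1; xi>>%VS = fullv)
  (C : {pred {ffun coset_of K -> Fbar}})
  (RC : is_cyclotomic_class q (G / K)%G C)
  (chi : {ffun coset_of K -> Fbar})
  (C_chi : C =i cyclotomic_coset q (G / K)%G chi)
  (chi_irr : chi \in lin_chars (G / K)%G) :
  let o := mulorder #|(G / K)%g| q in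
  let e := central_idem G (subfield_trace j) chi in
  let code := left_ideal e in
  let d := min_distance code in
  [/\ \dim code = o,
      basis_of code [seq e *m regular_repr F G (g ^+ i)%g | i <- seq.iota 0 o],
      (K \proper G -> (2 * #|K| <= d)%N) /\ (d <= wt e)%N
    & forall p k : nat, prime p -> odd p -> (0 < k)%N ->
        #|(G / K)%g| = (p ^ k)%N -> mulorder (p ^ k) q = totient (p ^ k) ->
        d = (2 * #|K|)%N].
Proof.
move=> o e code d.
have [sKG nG] := andP nKG.
have n_def : #|(G / K)%g| = #|G : K| by rewrite card_quotient.
have copK : coprime q #|(G / K)%g|.
  by apply: coprime_dvdr semisimple; rewrite dvdn_quotient.
have copF : coprime #|F| #|(G / K)%g| by rewrite card_F.
have GKg : coset K g \in (G / K)%g by rewrite mem_quotient.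
rewrite -n_def in prim_xi.
have prim_jxi : #|(G / K)%g|.-primitive_root (j xi).
  by rewrite fmorph_primitive_root.
have prim_chi := cyclotomic_coset_prim cycGK copK prim_jxi RC C_chi chi_irr.
have GK_exp x : x \in G ->
    exists2 i, (i < #|(G / K)%g|)%N & coset K x = (coset K g ^+ i)%g.
  move=> Gx; have := mem_quotient K Gx; rewrite cycGK => /cyclePmin[i lt_i ->].
  by exists i; rewrite // cycGK.
(* Values of [chi] are n-th roots of unity, hence powers of [j xi]. *)
have j_chi x : x \in G -> exists y, j y = chi (coset K x).
  case/GK_exp=> i _ ->; rewrite (lin_charX _ chi_irr) //.
  have [l ->] := prim_rootP prim_jxi (prim_expr_order prim_chi).
  by exists (xi ^+ l ^+ i); rewrite !rmorphXn.
pose lam x : E := odflt 0 [pick y : finvect_type E | j y == chi (coset K x)].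
have jlam x : x \in G -> j (lam x) = chi (coset K x).
  case/j_chi=> y jy; rewrite /lam; case: pickP => [z /eqP //|/(_ y)].
  by rewrite jy eqxx.
have lamM : {in G &, {morph lam : x y / (x * y)%g >-> x * y}}.
  move=> x y Gx Gy; apply: (fmorph_inj j).
  rewrite rmorphM /= !jlam ?groupM // morphM ?(subsetP nG) //=.
  by rewrite (lin_charM chi_irr) ?mem_quotient.
have prim_lam : #|(G / K)%g|.-primitive_root (lam g).
  by rewrite -(fmorph_primitive_root j) jlam.
(* [chi] is faithful on G/K, since its value at the generator is a primitive n-th root of unity. *)
have lamK : {in G, forall x, (lam x == 1) = (x \in K)}.
  move=> x Gx; rewrite -(inj_eq (fmorph_inj j)) rmorph1 jlam //.
  apply/eqP/idP => [|Kx]; last by rewrite coset_id // (lin_char1 chi_irr).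
  have [i _ xi_g] := GK_exp x Gx; rewrite xi_g (lin_charX _ chi_irr) // => /eqP.
  rewrite -(prim_order_dvd prim_chi) => dvd_i.
  rewrite coset_idr ?(subsetP nG) //.
  by rewrite xi_g; apply/eqP; rewrite -order_dvdn orderE -cycGK.
(* [xi] is a power of the primitive root [lam g]. *)
have E_lam : <<1; lam g>>%VS = fullv.
  apply/eqP; rewrite eqEsubv subvf -E_xi; apply/FadjoinP.
  rewrite sub1v; split=> //.
  have [l ->] := prim_rootP prim_lam (prim_expr_order prim_xi).
  by rewrite rpredX // memv_adjoin.
have dimE : \dim {:E} = o.
  by rewrite (dim_Fadjoin_root_unity copF prim_lam E_lam) card_F.
have basisE := power_basis E_lam; rewrite dimE in basisE.
have span_lam : <<[seq lam x | x in G]>>%VS = fullv.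
  apply/eqP; rewrite eqEsubv subvf /=.
  have /andP[/eqP<- _] := basisE; apply: sub_span => _ /mapP[i _ ->].
  by apply/imageP; exists (g ^+ i)%g; rewrite ?groupX ?(lam_exp lamM lamK).
have F'G : #|G|%:R != 0 :> F by rewrite natr_card_neq0 // card_F.
have nzT := field_trace_neq0 j.
have eE : e = trace_word G (field_trace j) lam 1.
  rewrite /e central_idemE // /trace_word; congr (_ *: _).
  by apply: eq_bigr => x Gx; rewrite mul1r /= /field_trace jlam ?groupV.
rewrite /d /code eE; split.
- by rewrite (dim_trace_code lamM span_lam F'G nzT).
- exact: (basis_trace_code lamM lamK span_lam F'G nzT).
- split.
    exact: (min_distance_trace_code_ge lamM lamK span_lam sKG F'G nzT).
  by rewrite (min_distance_trace_code_le lamM span_lam F'G nzT) ?oner_neq0.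
move=> p [//|k] p_pr _ _ n_pk o_pk.
have ltKG : K \proper G.
  rewrite properE sKG; apply: contraPN n_pk => /quotientS1->; rewrite cards1.
  by apply/eqP; rewrite ltn_eqF // -(exp1n k.+1) ltn_exp2r // prime_gt1.
have genG x : x \in G -> exists2 i, (i < p ^ k.+1)%N & x \in K :* (g ^+ i)%g.
  move=> Gx; have [i lt_i xg] := GK_exp x Gx; exists i; rewrite -?n_pk //.
  apply/rcoset_kercosetP; rewrite ?(subsetP nG) ?groupX //.
  by rewrite morphX ?(subsetP nG).
rewrite n_pk in prim_lam.
apply: (min_distance_trace_code_prime_power lamM lamK span_lam sKG F'G nzT
          Gg genG p_pr prim_lam _ ltKG).
by rewrite -o_pk -n_pk.
Qed.
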